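(* For every mesh $\mathcal T_h$ as in the context, the bilinear form $A_h$ satisfies $$A_h(v_h,v_h)\ge\frac12\|v_h\|_h^2\qquad\text{for all }v_h\in V_h^{\rm IFE}.$$
   Context: **Geometry.** $\Omega\subset\mathbb R^2$ is a convex polygonal domain; $\Gamma\subset\Omega$ is a compact $C^2$ curve without boundary dividing $\Omega$ into disjoint open sub-domains $\Omega^+,\Omega^-$, with $\Omega^-$ lying strictly inside $\Omega$; $\beta^\pm>0$ are constants. **Mesh.** $\mathcal T_h$ is a quasi-uniform triangulation of $\Omega$ into open triangles without hanging nodes, $h=\max_T \mathrm{diam}\,T$. $\mathcal E_h$ is the set of (open) edges; $\mathcal T_h^\Gamma=\{T\in\mathcal T_h:T\cap\Gamma\ne\emptyset\}$, $\mathcal E_h^\Gamma=\{e\in\mathcal E_h:e\cap\Gamma\neq\emptyset\}$ are the interface elements and interface edges; each interface edge is shared by two interface elements. Assumption A: $\Gamma$ meets the boundary of any interface element in at most two points and meets $\overline e$, $e\in\mathcal E_h$, in at most one point; for $T\in\mathcal T_h^\Gamma$ the two intersection points of $\Gamma$ and $\partial T$ are denoted $D,E$. **IFE space.** $\Gamma_h$ is the union of the segments $DE$ over interface elements; it divides $\Omega$ into $\Omega_h^+,\Omega_h^-$ (corresponding to $\Omega^+,\Omega^-$); $\mathbf n_h$ is its unit normal pointing toward $\Omega_h^+$ (constant on each interface element); $\beta_h=\beta^\pm$ on $\Omega_h^\pm$. For $T\in\mathcal T_h^\Gamma$, $T_h^\pm=T\cap\Omega_h^\pm$, and $S_h(T)$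 is the set of functions $\phi$ equal to an affine function $\phi^\pm$ on $T_h^\pm$ with $\phi^+(D)=\phi^-(D)$, $\phi^+(E)=\phi^-(E)$, $\beta^+\nabla\phi^+\cdot\mathbf n_h=\beta^-\nabla\phi^-\cdot\mathbf n_h$. $V_h^{\rm IFE}$ is the set of $\phi$ with $\phi|_T\in S_h(T)$ for $T\in\mathcal T_h^\Gamma$, $\phi|_T$ affine for the other elements, and $\phi$ continuous at every vertex of the mesh. **Method.** For $e\in\mathcal E_h^\Gamma$ shared by $T_1,T_2$, with unit normal $\mathbf n_e$ pointing from $T_1$ to $T_2$, put $[v]_e=v|_{T_1}-v|_{T_2}$ and $\{v\}_e=\frac12(v|_{T_1}+v|_{T_2})$. Let $W_h(T)=\{\nabla v_h:v_h\in S_h(T)\}$ and $W_e=\{w\in L^2(\Omega)^2: w|_{T_i}\in W_h(T_i),\ i=1,2,\ w=0\text{ on }\Omega\setminus(T_1\cup T_2)\}$. The lifting $r_e:L^2(e)\to W_e$ is defined by $\int_\Omega\beta_h r_e(\varphi)\cdot w_h\,dx=\int_e\{\beta_hw_h\cdot\mathbf n_e\}_e\varphi\,ds$ for all $w_h\in W_e$. Then $A_h=a_h+s_h$ with $$a_h(u,v)=\sum_{T\in\mathcal T_h}\int_T\beta_h\nabla u\cdot\nabla v\,dx-\sum_{e\in\mathcal E_h^\Gamma}\int_e\big(\{\beta_h\nabla u\cdot\mathbf n_e\}_e[v]_e+\{\beta_h\nabla v\cdot\mathbf n_e\}_e[u]_e\big)ds,$$ $$s_h(u,v)=4\sum_{e\in\mathcal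 E_h^\Gamma}\int_\Omega\beta_h r_e([u]_e)\cdot r_e([v]_e)\,dx.$$ Finally $\|v\|_h^2=\sum_{T\in\mathcal T_h}\|\sqrt{\beta_h}\nabla v\|^2_{L^2(T)}$. *)

(* Defs.v *)
From HB Require Import structures.
From mathcomp Require Import all_boot all_order all_algebra.
From mathcomp Require Import all_classical all_reals all_analysis.

Set Implicit Arguments.
Unset Strict Implicit.
Unset Printing Implicit Defensive.

Import Order.TTheory GRing.Theory Num.Theory.
Import numFieldNormedType.Exports.

Local Open Scope classical_set_scope.
Local Open Scope ring_scope.

Section Plane.
Variable R : realType.
Local Notation plane := (R * R)%type.

Definition dotp (x y : plane) : R := x.1 * y.1 + x.2 * y.2.

(* The library norm on R * R is the max norm, hence a separate Euclidean one. *)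
Definition enorm (x : plane) : R := Num.sqrt (dotp x x).

Definition perp (x : plane) : plane := (- x.2, x.1).

Definition affine_fun (g : plane) (c : R) (x : plane) : R := dotp g x + c.

Definition leb2 : {measure set (measurableTypeR R * measurableTypeR R) -> \bar R} :=
  (@lebesgue_measure R \x @lebesgue_measure R)%E.

Definition L2 (A : set plane) (f : plane -> R) : Prop :=
  measurable_fun A f /\ leb2.-integrable A (fun x => (f x ^+ 2)%:E).

Definition L2vec (A : set plane) (w : plane -> plane) : Prop :=
  L2 A (fun x => (w x).1) /\ L2 A (fun x => (w x).2).

Definition L2norm_vec (A : set plane) (w : plane -> plane) : R :=
  Num.sqrt (\int[leb2]_(x in A) enorm (w x) ^+ 2).

Definition diam (A : set plane) : R :=
  sup [set d | exists x y : plane, [/\ A x, A y & d = enorm (x - y)]].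

(* Limit at x from inside A. *)
Definition trace (A : set plane) (f : plane -> R) (x : plane) : R :=
  lim (f y @[y --> within A (nbhs x)]).

Definition domain (A : set plane) : Prop := [/\ open A, connected A & A !=set0].

Definition convex_polygonal_domain (A : set plane) : Prop :=
  [/\ A !=set0, bounded_set A &
      exists (k : nat) (n : 'I_k -> plane) (c : 'I_k -> R),
        A = [set x | forall i, dotp (n i) x < c i]].

Definition C2 (g : R -> R) : Prop :=
  [/\ forall s : R, derivable g s 1,
      forall s : R, derivable (derive1 g) s 1 &
      continuous (derive1 (derive1 g))].

(* A compact connected one-dimensional C^2 submanifold without boundary:
   near each of its points it is the graph of a C^2 function over a line. *)
Definition closed_C2_curve (G : set plane) : Prop :=
  [/\ compact G, connected G, G !=set0 &
      forall p : plane, G p ->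
        exists (t : plane) (g : R -> R), [/\ enorm t = 1, C2 g &
          \forall y \near p,
            G y <-> exists s : R, y = p + s *: t + g s *: perp t]].

(* G divides A into the sub-domains Ap and Am, with Am strictly inside A. *)
Definition divides (A G Ap Am : set plane) : Prop :=
  [/\ G `<=` A, A `\` G = Ap `|` Am, Ap `&` Am = set0,
      domain Ap /\ domain Am & closure Am `<=` A].

End Plane.

(* Vertices are indexed by a finite type; a triangle or an edge is a set of
   vertex indices, of cardinality 3 or 2. The fields ptD, ptE, nh are used only
   on interface elements and tri1, tri2, ne only on interface edges. *)
Record ife_data (R : realType) := IfeData {
  Omega : set (R * R);
  Gamma : set (R * R);
  Omegap : set (R * R);
  Omegam : set (R * R);
  betap : R;
  betam : R;
  vertex : finType;
  vtx : vertex -> R * R;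
  Th : {set {set vertex}};
  ptD : {set vertex} -> R * R;
  ptE : {set vertex} -> R * R;
  Omegahp : set (R * R);
  Omegahm : set (R * R);
  nh : {set vertex} -> R * R;
  tri1 : {set vertex} -> {set vertex};
  tri2 : {set vertex} -> {set vertex};
  ne : {set vertex} -> R * R
}.

Section Method.
Variables (R : realType) (M : ife_data R).
Local Notation plane := (R * R)%type.
Local Notation simplex := {set vertex M}.

Definition open_simplex (S : simplex) : set plane :=
  [set x | exists l : vertex M -> R,
     [/\ forall a, a \in S -> 0 < l a,
         \sum_(a in S) l a = 1 & x = \sum_(a in S) l a *: vtx a]].

Definition closed_simplex (S : simplex) : set plane :=
  [set x | exists l : vertex M -> R,
     [/\ forall a, a \in S -> 0 <= l a,
         \sum_(a in S) l a = 1 & x = \sum_(a in S) l a *: vtx a]].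

Definition affinely_independent (S : simplex) : Prop :=
  forall l : vertex M -> R,
    \sum_(a in S) l a = 0 -> \sum_(a in S) l a *: vtx a = 0 ->
    forall a, a \in S -> l a = 0.

(* The last clause excludes hanging nodes: two closed triangles meet exactly in
   the closed simplex spanned by their common vertices (empty if there are
   none). *)
Definition triangulation : Prop :=
  [/\ forall T, T \in Th M -> #|T| = 3%N /\ affinely_independent T,
      forall a, exists2 T, T \in Th M & a \in T,
      closure (Omega M) = \bigcup_(T in [set T | T \in Th M]) closed_simplex T &
      forall T1 T2, T1 \in Th M -> T2 \in Th M ->
        closed_simplex T1 `&` closed_simplex T2 = closed_simplex (T1 :&: T2)].

Definition mesh_size : R := \big[Num.max/0]_(T in Th M) diam (open_simplex T).

(* Each element contains a disc whose diameter d satisfies mesh_size <= sigma d. *)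
Definition quasi_uniform (sigma : R) : Prop :=
  forall T, T \in Th M -> exists (c : plane) (d : R),
    [/\ 0 < d, [set x | enorm (x - c) < d / 2] `<=` open_simplex T &
        mesh_size <= sigma * d].

Definition Eh : {set simplex} :=
  [set e : simplex | (#|e| == 2%N) && [exists T in Th M, e \subset T]].

Definition meets_interface (S : simplex) : Prop :=
  (open_simplex S `&` Gamma M) !=set0.

Definition interface_element (T : simplex) : Prop :=
  T \in Th M /\ meets_interface T.

Definition interface_edge (e : simplex) : Prop :=
  e \in Eh /\ meets_interface e.

Definition assumptionA : Prop :=
  (forall T, interface_element T ->
     ptD T <> ptE T /\
     Gamma M `&` (closed_simplex T `\` open_simplex T) = [set ptD T; ptE T]) /\
  (forall e, e \in Eh -> forall x y : plane,
     Gamma M x -> closed_simplex e x -> Gamma M y -> closed_simplex e y -> x = y).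

Definition interface_edges_shared : Prop :=
  forall e, interface_edge e ->
    [/\ interface_element (tri1 e), interface_element (tri2 e),
        tri1 e <> tri2 e, e \subset tri1 e & e \subset tri2 e].

Definition edge_normals : Prop :=
  forall e, interface_edge e ->
    [/\ enorm (ne e) = 1,
        forall x y : plane, open_simplex e x -> open_simplex e y ->
          dotp (ne e) (x - y) = 0 &
        forall x1 x2 : plane, open_simplex (tri1 e) x1 -> open_simplex (tri2 e) x2 ->
          0 < dotp (ne e) (x2 - x1)].

Definition Gammah : set plane :=
  [set x | exists T, interface_element T /\
     exists s : R, 0 <= s <= 1 /\ x = ptD T + s *: (ptE T - ptD T)].

(* The last two clauses express that Omega_h^+ and Omega_h^- correspond to
   Omega^+ and Omega^-. *)
Definition discrete_subdomains : Prop :=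
  [/\ divides (Omega M) Gammah (Omegahp M) (Omegahm M),
      forall a : vertex M, Omegap M (vtx a) -> Omegahp M (vtx a) &
      forall a : vertex M, Omegam M (vtx a) -> Omegahm M (vtx a)].

Definition discrete_normals : Prop :=
  forall T, interface_element T ->
    [/\ enorm (nh T) = 1,
        dotp (nh T) (ptE T - ptD T) = 0 &
        forall s : R, 0 < s < 1 -> \forall t \near (0 : R)^'+,
          Omegahp M (ptD T + s *: (ptE T - ptD T) + t *: nh T)].

(* The values on the null set Gamma_h, here betam, play no role. *)
Definition betah (x : plane) : R := if x \in Omegahp M then betap M else betam M.

(* Elementwise gradient; it jumps across the null set Gamma_h, where it is
   given the value 0. It is only evaluated inside elements. *)
Definition grad (v : plane -> R) (x : plane) : plane :=
  if x \in Gammah then 0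
  else ('D_((1 : R), (0 : R)) v x, 'D_((0 : R), (1 : R)) v x).

(* Only the restriction of phi to T^+ and T^- matters: elements of the IFE space
   are functions up to the null set formed by the mesh edges and Gamma_h. *)
Definition Sh (T : simplex) (phi : plane -> R) : Prop :=
  exists (gp gm : plane) (cp cm : R),
    [/\ forall x : plane, open_simplex T x -> Omegahp M x -> phi x = affine_fun gp cp x,
        forall x : plane, open_simplex T x -> Omegahm M x -> phi x = affine_fun gm cm x,
        affine_fun gp cp (ptD T) = affine_fun gm cm (ptD T),
        affine_fun gp cp (ptE T) = affine_fun gm cm (ptE T) &
        betap M * dotp gp (nh T) = betam M * dotp gm (nh T)].

Definition mesh_interior : set plane :=
  \bigcup_(T in [set T | T \in Th M]) open_simplex T.

(* On an edge v may have two different traces, so continuity at a vertex is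
   understood from within the union of the open elements. *)
Definition VhIFE (v : plane -> R) : Prop :=
  [/\ forall T, interface_element T -> Sh T v,
      forall T, T \in Th M -> ~ interface_element T ->
        exists (g : plane) (c : R),
          forall x : plane, open_simplex T x -> v x = affine_fun g c x &
      forall a : vertex M,
        v y @[y --> within mesh_interior (nbhs (vtx a))] --> v (vtx a)].

(* Affine parametrisation of e by [0, 1]; the integral over e and L^2(e) do not
   depend on the order in which enum lists the two endpoints. *)
Definition edge_point (e : simplex) (t : R) : plane :=
  if enum e is [:: a; b] then vtx a + t *: (vtx b - vtx a) else 0.

Definition edge_integral (e : simplex) (f : plane -> R) : R :=
  enorm (edge_point e 1 - edge_point e 0) *
  \int[@lebesgue_measure R]_(t in `]0, 1[%classic) f (edge_point e t).

Definition L2edge (e : simplex) (f : plane -> R) : Prop :=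
  measurable_fun (`]0, 1[%classic : set (measurableTypeR R)) (fun t : R => f (edge_point e t)) /\
  (@lebesgue_measure R).-integrable `]0, 1[%classic
    (fun t : R => (f (edge_point e t) ^+ 2)%:E).

Definition jump (e : simplex) (f : plane -> R) (x : plane) : R :=
  trace (open_simplex (tri1 e)) f x - trace (open_simplex (tri2 e)) f x.

Definition average (e : simplex) (f : plane -> R) (x : plane) : R :=
  (trace (open_simplex (tri1 e)) f x + trace (open_simplex (tri2 e)) f x) / 2.

Definition flux_average (e : simplex) (w : plane -> plane) : plane -> R :=
  average e (fun x => betah x * dotp (w x) (ne e)).

(* The piecewise constant representative of w is used on T, so that w has
   traces on the edges. *)
Definition Wh (T : simplex) (w : plane -> plane) : Prop :=
  exists2 phi, Sh T phi & forall x : plane, open_simplex T x -> w x = grad phi x.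

Definition We (e : simplex) (w : plane -> plane) : Prop :=
  [/\ L2vec (Omega M) w, Wh (tri1 e) w, Wh (tri2 e) w &
      forall x : plane, Omega M x -> ~ open_simplex (tri1 e) x ->
        ~ open_simplex (tri2 e) x -> w x = 0].

(* r is the family of liftings r_e : L^2(e) -> W_e; the conditions determine
   r e phi on Omega. *)
Definition is_lifting (r : simplex -> (plane -> R) -> (plane -> plane)) : Prop :=
  forall e, interface_edge e -> forall phi, L2edge e phi ->
    We e (r e phi) /\
    forall w, We e w ->
      \int[@leb2 R]_(x in Omega M) (betah x * dotp (r e phi x) (w x)) =
      edge_integral e (fun x => flux_average e w x * phi x).

Definition ah (u v : plane -> R) : R :=
  \sum_(T in Th M)
     \int[@leb2 R]_(x in open_simplex T) (betah x * dotp (grad u x) (grad v x)) -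
  \sum_(e in Eh | `[< meets_interface e >])
     edge_integral e (fun x => flux_average e (grad u) x * jump e v x +
                               flux_average e (grad v) x * jump e u x).

Definition sh (r : simplex -> (plane -> R) -> (plane -> plane)) (u v : plane -> R) : R :=
  4 * \sum_(e in Eh | `[< meets_interface e >])
     \int[@leb2 R]_(x in Omega M)
        (betah x * dotp (r e (jump e u) x) (r e (jump e v) x)).

Definition Ah r (u v : plane -> R) : R := ah u v + sh r u v.

Definition normh (v : plane -> R) : R :=
  Num.sqrt (\sum_(T in Th M)
    L2norm_vec (open_simplex T) (fun x => Num.sqrt (betah x) *: grad v x) ^+ 2).

End Method.

(* Main.v *)
(* On an interface edge e, the elementwise gradient of v restricted to the two
   triangles sharing e, and extended by 0, lies in W_e. Testing the lifting of
   [v] with it turns the consistency term into a volume integral, and Young's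
   inequality 2 r.w <= 4 |r|^2 + |w|^2 / 4 absorbs the lifting in s_h. The other
   part costs a quarter of the energy of the two triangles, and every triangle
   is charged at most twice: each of its interface edges contains one of the two
   intersection points D, E of the curve with its boundary, and two distinct open
   edges are disjoint.
   The lifting may only be applied to [v] once [v] is known to be in L^2(e): off
   the finitely many points D, E, the edge avoids Gamma_h, because each segment
   DE joins two different edges of its triangle. *)

Require Import Defs.
From HB Require Import structures.
From mathcomp Require Import all_boot all_order all_algebra.
From mathcomp Require Import all_classical all_reals all_analysis.
From mathcomp Require Import measurable_realfun ring lra.

Set Implicit Arguments.
Unset Strict Implicit.
Unset Printing Implicit Defensive.

Import Order.TTheory GRing.Theory Num.Theory.
Import numFieldNormedType.Exports.

Local Open Scope classical_set_scope.
Local Open Scope ring_scope.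

(** * Dot product, affine functions and convex polygons *)

Section Plane.
Variable R : realType.
Local Notation plane := (R * R)%type.
Implicit Types x y g : plane.

Lemma dotpC x y : dotp x y = dotp y x.
Proof. by rewrite /dotp; ring. Qed.

Lemma dotpDr g x y : dotp g (x + y) = dotp g x + dotp g y.
Proof. by case: x => x1 x2; case: y => y1 y2; rewrite /dotp /=; ring. Qed.

Lemma dotp0r g : dotp g 0 = 0.
Proof. by rewrite /dotp /= !mulr0 addr0. Qed.

Lemma dotp0l x : dotp 0 x = 0.
Proof. by rewrite dotpC dotp0r. Qed.

Lemma dotpZr g a x : dotp g (a *: x) = a * dotp g x.
Proof. by case: x => x1 x2; rewrite /dotp /= /GRing.scale /=; ring. Qed.

Lemma dotpZl a g x : dotp (a *: g) x = a * dotp g x.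
Proof. by rewrite dotpC dotpZr dotpC. Qed.

Lemma dotp_ge0 x : 0 <= dotp x x.
Proof. by rewrite /dotp addr_ge0 // -expr2 sqr_ge0. Qed.

Lemma dotp_sum (I : finType) (P : pred I) g (l : I -> R) (F : I -> plane) :
  dotp g (\sum_(i | P i) l i *: F i) = \sum_(i | P i) l i * dotp g (F i).
Proof.
rewrite (big_morph (dotp g) (dotpDr g) (dotp0r g)).
by apply: eq_bigr => i _; rewrite dotpZr.
Qed.

Lemma sqr_enorm x : enorm x ^+ 2 = dotp x x.
Proof. by rewrite /enorm sqr_sqrtr// dotp_ge0. Qed.

Lemma continuous_affine_fun g (c : R) : continuous (affine_fun g c).
Proof.
move=> x; rewrite /affine_fun /dotp.
apply: cvgD; last exact: cvg_cst.
by apply: cvgD; apply: cvgM; (try exact: cvg_cst); [exact: cvg_fst|exact: cvg_snd].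
Qed.

Lemma open_affine_gt0 g (c : R) : open [set x | 0 < affine_fun g c x].
Proof.
apply: (@open_comp _ _ (affine_fun g c) [set y | 0 < y]); last exact: open_gt.
by move=> x _; exact: continuous_affine_fun.
Qed.

Lemma closed_dotp_le g (c : R) : closed [set x | dotp g x <= c].
Proof.
rewrite (_ : [set x | _] = ~` [set x | 0 < affine_fun g (- c) x]); last first.
  by apply/seteqP; split => x /=; rewrite /affine_fun subr_gt0 ltNge;
     [move=> ->|move/negP; rewrite negbK].
by apply: open_closedC; exact: open_affine_gt0.
Qed.

Lemma open_line (U : set plane) x d : open U -> U x ->
  \forall t \near (0 : R)^'+, U (x + t *: d).
Proof.
move=> oU Ux.
have : (x + t *: d) @[t --> (0 : R)^'+] --> x.
  rewrite -[X in _ --> X]addr0 -[X in _ + X](scale0r d).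
  apply: cvgD; first exact: cvg_cst.
  apply: cvgZr_tmp.
  by apply: cvg_at_right_filter; exact: cvg_id.
by apply; move: oU; rewrite openE; apply.
Qed.

Lemma convex_polygonal_open (A : set plane) : convex_polygonal_domain A -> open A.
Proof.
move=> [_ _ [k [n [c ->]]]].
have oi i : open [set x | dotp (n i) x < c i].
  rewrite (_ : [set x | _] = [set x | 0 < affine_fun (- n i) (c i) x]).
    exact: open_affine_gt0.
  apply/seteqP; split => x /=;
    by rewrite /affine_fun -scaleN1r dotpZl mulN1r addrC subr_gt0.
rewrite openE => x /= Ax.
apply: (@filter_forall _ _ (fun i => [set x | dotp (n i) x < c i]) (nbhs x)) => i.
by move: (oi i); rewrite openE; apply; exact: Ax.
Qed.

Lemma closure_half_planes k (n : 'I_k -> plane) (c : 'I_k -> R) i x :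
  closure [set x | forall i, dotp (n i) x < c i] x -> dotp (n i) x <= c i.
Proof.
move=> cx; apply: (closed_dotp_le (g := n i) (c := c i)).
by apply: closureS cx => y /= /(_ i) /ltW.
Qed.

(** If a point of [U] violated the i-th constraint, a short move along [n i] would stay in [U],
    hence in the closure of [A], where the constraint holds in its weak form; this forces [n i] to
    vanish. Applied to open elements, which are a priori known to lie only in the closure of the
    domain. *)
Lemma open_sub_convex_polygonal (A U : set plane) :
  convex_polygonal_domain A -> open U -> U `<=` closure A -> U `<=` A.
Proof.
move=> [[x0 Ax0] _ [k [n [c Ae]]]] oU; rewrite Ae in Ax0 * => UA x Ux i /=.
rewrite ltNge; apply/negP => cx.
have /= H := open_line (n i) oU Ux.
have [t [t0 Ut]] : exists t : R, 0 < t /\ U (x + t *: n i).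
  near ((0 : R)^'+) => t; exists t; split; first by near: t; exact: nbhs_right_gt.
  by near: t.
have := closure_half_planes i (UA _ Ut).
rewrite dotpDr dotpZr => le1.
have nn : dotp (n i) (n i) <= 0.
  by rewrite -(pmulr_rle0 _ t0) -(lerD2l (dotp (n i) x)) addr0 (le_trans le1).
have n0 : n i = 0.
  have [] := (sqr_ge0 (n i).1, sqr_ge0 (n i).2).
  move: nn; rewrite /dotp -!expr2 => nn h1 h2.
  have e1 : (n i).1 ^+ 2 == 0 by rewrite eq_le h1 andbT (le_trans _ nn)// lerDl.
  have e2 : (n i).2 ^+ 2 == 0 by rewrite eq_le h2 andbT (le_trans _ nn)// lerDr.
  by rewrite (surjective_pairing (n i)); congr pair; apply/eqP; rewrite -sqrf_eq0.
(* A constraint with zero normal reads 0 < [c i]; the point [x0] of [A] shows that it holds, while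
   [cx] denies it. *)
move: (Ax0 i) cx; rewrite n0 /dotp /= !mul0r addr0 => h1 h2.
by have := lt_le_trans h1 h2; rewrite ltxx.
Unshelve. all: by end_near. Qed.

End Plane.

(** * Barycentric coordinates, faces and open simplices *)

Section Simplices.
Variables (R : realType) (M : ife_data R).
Local Notation plane := (R * R)%type.
Local Notation simplex := {set vertex M}.
Implicit Types (S T e : simplex) (x y : plane).

(** Lets coordinates on a face be read as coordinates on the whole simplex, extended by zero. *)
Lemma big_mem_subset (V : nmodType) (F : vertex M -> V) S T : S \subset T ->
  \sum_(a in T) (if a \in S then F a else 0) = \sum_(a in S) F a.
Proof.
move=> ST; rewrite -big_mkcondr; apply: eq_bigl => a /=.
by apply/andP/idP => [[]//|aS]; split=> //; exact: (fintype.subsetP ST).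
Qed.

(** Uniqueness of barycentric coordinates for two faces of one simplex: the difference of the two
    families, extended by zero, is an affine relation on [T]. *)
Lemma affinely_independent_eq S S' T (l l' : vertex M -> R) :
  affinely_independent T -> S \subset T -> S' \subset T ->
  \sum_(a in S) l a = \sum_(a in S') l' a ->
  \sum_(a in S) l a *: vtx a = \sum_(a in S') l' a *: vtx a ->
  forall a, a \in T ->
    (if a \in S then l a else 0) = (if a \in S' then l' a else 0).
Proof.
move=> iT ST S'T e1 e2 a aT; apply/eqP; rewrite -subr_eq0; apply/eqP.
pose d a := (if a \in S then l a else 0) - (if a \in S' then l' a else 0).
apply: (iT d) => //; rewrite /d.
  by rewrite big_split /= sumrN !big_mem_subset // e1 subrr.
rewrite (eq_bigr (fun b => (if b \in S then l b *: vtx b else 0) -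
                           (if b \in S' then l' b *: vtx b else 0))).
  by rewrite big_split /= sumrN !big_mem_subset // e2 subrr.
by move=> b _; rewrite scalerBl; congr (_ - _); case: ifP; rewrite ?scale0r.
Qed.

Lemma open_closed_simplex x S : open_simplex S x -> closed_simplex S x.
Proof. by move=> [l [l0 l1 ->]]; exists l; split=> // a /l0/ltW. Qed.

Lemma closed_simplexS S T x : S \subset T -> closed_simplex S x -> closed_simplex T x.
Proof.
move=> ST [l [l0 l1 ->]]; exists (fun a => if a \in S then l a else 0); split.
- by move=> a _; case: ifP => // /l0.
- by rewrite big_mem_subset.
- rewrite -(big_mem_subset _ ST); apply: eq_bigr => a _.
  by case: ifP; rewrite ?scale0r.
Qed.

(** The coordinates of [x] are positive on all of [S] and vanish off [S'], and they are unique
    within [T]. This is the tool that compares faces sharing a point. *)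
Lemma open_simplex_sub S S' T x : affinely_independent T ->
  S \subset T -> S' \subset T -> open_simplex S x -> closed_simplex S' x ->
  S \subset S'.
Proof.
move=> iT ST S'T [l [l0 l1 xl]] [l' [l0' l1' xl']]; apply/fintype.subsetP => a aS.
have := affinely_independent_eq iT ST S'T (l := l) (l' := l').
rewrite l1 l1' -xl -xl' => /(_ erefl erefl a (fintype.subsetP ST _ aS)).
by rewrite aS; case: ifP => // _ la; have := l0 _ aS; rewrite la ltxx.
Qed.

Lemma vtx_closed_simplex S (a : vertex M) : a \in S -> closed_simplex S (vtx a).
Proof.
move=> aS; apply: (@closed_simplexS [set a]%SET); first by rewrite finset.sub1set.
by exists (fun=> 1); split=> //; rewrite big_set1 // scale1r.
Qed.

Lemma open_simplex_segment S x y s : closed_simplex S x -> open_simplex S y ->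
  0 < s <= 1 -> open_simplex S (x + s *: (y - x)).
Proof.
move=> [l [l0 l1 ->]] [l' [l0' l1' ->]] /andP[s0 s1].
exists (fun a => (1 - s) * l a + s * l' a); split.
- move=> a aS; rewrite ltr_wpDl// ?mulr_gt0// ?l0' ?mulr_ge0 ?l0 ?subr_ge0//.
- by rewrite big_split /= -!mulr_sumr l1 l1' !mulr1 subrK.
- rewrite [RHS](eq_bigr (fun a => (1 - s) *: (l a *: vtx a) + s *: (l' a *: vtx a))).
    by rewrite big_split /= -!scaler_sumr scalerBl scale1r scalerBr -addrA [- _ + _]addrC.
  by move=> a _; rewrite !scalerA -scalerDl.
Qed.

(** Moving from [x] towards an interior point enters the open simplex at once. Points of an edge
    thereby become limit points of the adjacent open element, so that traces are meaningful
    there. *)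
Lemma closure_open_simplex S : open_simplex S !=set0 ->
  closed_simplex S `<=` closure (open_simplex S).
Proof.
move=> [y Sy] x Sx U Ux.
have [t [t01 Ut]] : exists t : R, 0 < t <= 1 /\ U (x + t *: (y - x)).
  have H := open_line (y - x) (open_interior U) Ux.
  near ((0 : R)^'+) => t; exists t; split.
    by apply/andP; split; near: t; [exact: nbhs_right_gt|exact: nbhs_right_le].
  by apply: interior_subset; near: t.
by exists (x + t *: (y - x)); split => //; exact: open_simplex_segment.
Unshelve. all: by end_near. Qed.

Lemma cards3 (I : finType) (A : {set I}) : #|A| = 3%N ->
  exists a b c, [/\ a != b, a != c, b != c & A = [set a; b; c]%SET].
Proof.
move=> A3; have : (0 < #|A|)%N by rewrite A3.
move=> /card_gt0P[a aA].
have : #|(A :\ a)%SET| == 2%N.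
  by move: (cardsD1 a A); rewrite aA A3 => /eqP; rewrite -[3%N]/(1 + 2)%N eqn_add2l eq_sym.
move=> /cards2P[b [c [bc Ae]]].
have : b \in (A :\ a)%SET by rewrite Ae !inE eqxx.
have : c \in (A :\ a)%SET by rewrite Ae !inE eqxx orbT.
rewrite !inE => /andP[ca cA] /andP[ba bA].
exists a, b, c; split; rewrite // 1?eq_sym//.
by rewrite -(finset.setD1K aA) Ae finset.setUA.
Qed.

Lemma big_set3 (V : nmodType) (I : finType) (F : I -> V) (a b c : I) :
  a != b -> a != c -> b != c -> \sum_(i in [set a; b; c]%SET) F i = F a + F b + F c.
Proof.
move=> ab ac bc; rewrite -finset.setUA big_setU1 ?inE ?negb_or ?ab ?ac//=.
by rewrite big_setU1 ?inE//= big_set1 addrA.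
Qed.

(** By Cramer's rule the barycentric coordinates are affine functions of the point, so the open
    triangle is an intersection of three open half-planes. *)
Lemma open_open_simplex T : #|T| = 3%N -> affinely_independent T ->
  open (open_simplex T).
Proof.
move=> /cards3[a [b [c [ab ac bc ->]]]] iT.
case Ea : (vtx a) => [a1 a2]; case Eb : (vtx b) => [b1 b2]; case Ec : (vtx c) => [c1 c2].
pose d := (b1 - a1) * (c2 - a2) - (b2 - a2) * (c1 - a1).
have ind la lb lc : la + lb + lc = 0 ->
    la * a1 + lb * b1 + lc * c1 = 0 -> la * a2 + lb * b2 + lc * c2 = 0 ->
    [/\ la = 0, lb = 0 & lc = 0].
  move=> e0 e1 e2.
  pose l i := if i == a then la else if i == b then lb else lc.
  have lla : l a = la by rewrite /l eqxx.
  have llb : l b = lb by rewrite /l eq_sym (negbTE ab) eqxx.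
  have llc : l c = lc by rewrite /l ![c == _]eq_sym (negbTE ac) (negbTE bc).
  have := iT l; rewrite !big_set3// lla llb llc Ea Eb Ec => /(_ e0) H.
  have {}H : forall i, i \in [set a; b; c]%SET -> l i = 0.
    apply: H; rewrite -[LHS]/(la * a1 + lb * b1 + lc * c1, la * a2 + lb * b2 + lc * c2).
    by rewrite e1 e2.
  by split; [rewrite -lla|rewrite -llb|rewrite -llc]; apply: H; rewrite !inE eqxx ?orbT.
(* If [d] vanished, coordinate differences of the vertices would provide two affine relations; these
   make all three vertices coincide, and then -1, 1, 0 is a nontrivial relation. *)
have d0 : d != 0.
  apply/eqP => d0.
  have [_ e1 e2] : [/\ (c2 - a2 - (b2 - a2)) * (-1) = 0, c2 - a2 = 0 & - (b2 - a2) = 0].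
    by apply: ind; move: d0; rewrite /d; lra.
  have [_ e3 e4] : [/\ (c1 - a1 - (b1 - a1)) * (-1) = 0, c1 - a1 = 0 & - (b1 - a1) = 0].
    by apply: ind; move: d0; rewrite /d; lra.
  have [_ h _] : [/\ (-1 : R) = 0, (1 : R) = 0 & (0 : R) = 0] by apply: ind; lra.
  by move/eqP: h; rewrite oner_eq0.
(* Slopes and constants of the coordinates belonging to [b] and [c]; the coordinate of [a] is one
   minus their sum. *)
pose gb : plane := ((c2 - a2) / d, - (c1 - a1) / d).
pose kb := - dotp gb (a1, a2).
pose gc : plane := (- (b2 - a2) / d, (b1 - a1) / d).
pose kc := - dotp gc (a1, a2).
rewrite (_ : open_simplex _ = [set x | 0 < affine_fun (- (gb + gc)) (1 - kb - kc) x] `&`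
   ([set x | 0 < affine_fun gb kb x] `&` [set x | 0 < affine_fun gc kc x])).
  by apply: openI; [|apply: openI]; exact: open_affine_gt0.
apply/seteqP; split => [x [l [l0]]|[x1 x2] /= [pa [pb pc]]].
  rewrite !big_set3// Ea Eb Ec => l1 ->.
  rewrite /affine_fun /kb /kc /gb /gc /dotp /=.
  set la := l a; set lb := l b; set lc := l c.
  have ela : la = 1 - lb - lc by rewrite -l1; rewrite -/la -/lb -/lc; ring.
  have pa : 0 < la by apply: l0; rewrite !inE eqxx ?orbT.
  have pb : 0 < lb by apply: l0; rewrite !inE eqxx ?orbT.
  have pc : 0 < lc by apply: l0; rewrite !inE eqxx ?orbT.
  rewrite /GRing.scale /=; split; [|split].
  - rewrite [ltRHS](_ : _ = la)// {1}ela /d; rewrite ela; field; exact: d0.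
  - rewrite [ltRHS](_ : _ = lb)// ela; rewrite /d; field; exact: d0.
  - rewrite [ltRHS](_ : _ = lc)// ela; rewrite /d; field; exact: d0.
set lb := affine_fun gb kb (x1, x2) in pb.
set lc := affine_fun gc kc (x1, x2) in pc.
have ela : affine_fun (- (gb + gc)) (1 - kb - kc) (x1, x2) = 1 - lb - lc.
  by rewrite /lb /lc /affine_fun /dotp /=; ring.
rewrite ela in pa.
pose l i := if i == a then 1 - lb - lc else if i == b then lb else lc.
have lla : l a = 1 - lb - lc by rewrite /l eqxx.
have llb : l b = lb by rewrite /l eq_sym (negbTE ab) eqxx.
have llc : l c = lc by rewrite /l ![c == _]eq_sym (negbTE ac) (negbTE bc).
exists l; split.
- by move=> i; rewrite !inE => /orP[/orP[]|] /eqP->; rewrite ?lla ?llb ?llc.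
- by rewrite big_set3// lla llb llc; ring.
- rewrite big_set3// lla llb llc Ea Eb Ec.
  rewrite -[RHS]/((1 - lb - lc) * a1 + lb * b1 + lc * c1, (1 - lb - lc) * a2 + lb * b2 + lc * c2).
  rewrite /lb /lc /affine_fun /kb /kc /gb /gc /dotp /=.
  by congr pair; rewrite /d; field; exact: d0.
Qed.

End Simplices.

(** * Bounded measurable functions *)

Section BoundedMeasurable.
Context {d : measure_display} {X : measurableType d} {R : realType}.
Implicit Types (A B D : set X) (f g : X -> R).

(** A class closed under sums, products and gluing over two measurable pieces, and contained in the
    integrable functions on domains of finite measure. All piecewise affine data are handled through
    it. *)
Definition bounded_measurable D f :=
  measurable_fun D f /\ exists K : R, forall x, D x -> `|f x| <= K.

Lemma bounded_measurable_cst D (c : R) : bounded_measurable D (fun=> c).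
Proof. by split; [exact: measurable_cst|exists `|c|]. Qed.

Lemma eq_bounded_measurable D f g : (forall x, D x -> f x = g x) ->
  bounded_measurable D f -> bounded_measurable D g.
Proof.
move=> fg [mf [K fK]]; split; last by exists K => x Dx; rewrite -fg// fK.
by apply: eq_measurable_fun mf => x; rewrite inE => /fg.
Qed.

Lemma bounded_measurableU A B f : measurable A -> measurable B ->
  bounded_measurable A f -> bounded_measurable B f ->
  bounded_measurable (A `|` B) f.
Proof.
move=> mA mB [fA [K fK]] [fB [L fL]]; split; first by apply/measurable_funU.
by exists (Num.max K L) => x [/fK|/fL] h; rewrite le_max h ?orbT.
Qed.

Lemma bounded_measurableD D f g : bounded_measurable D f ->
  bounded_measurable D g -> bounded_measurable D (fun x => f x + g x).
Proof.
move=> [mf [K fK]] [mg [L gL]]; split; first exact: measurable_funD.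
by exists (K + L) => x Dx; rewrite (le_trans (ler_normD _ _))// lerD ?fK ?gL.
Qed.

Lemma bounded_measurableM D f g : bounded_measurable D f ->
  bounded_measurable D g -> bounded_measurable D (fun x => f x * g x).
Proof.
move=> [mf [K fK]] [mg [L gL]]; split; first exact: measurable_funM.
by exists (K * L) => x Dx; rewrite normrM ler_pM ?fK ?gL.
Qed.

Lemma bounded_measurable_integrable (mu : {measure set X -> \bar R}) D f :
  measurable D -> (mu D < +oo)%E -> bounded_measurable D f ->
  mu.-integrable D (EFin \o f).
Proof.
move=> mD muD [mf [K fK]]; apply: measurable_bounded_integrable => //.
exists K; split; first exact: num_real.
by move=> L KL x /= /fK /le_trans -> //; exact: ltW.
Qed.

End BoundedMeasurable.

(** Every subset of a finite set of reals is measurable, so the function may be arbitrary. This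
    absorbs the points where a trace has no controlled value. *)
Lemma bounded_measurable_finite (R : realType) (F : set (measurableTypeR R))
  (f : measurableTypeR R -> R) : finite_set F -> bounded_measurable F f.
Proof.
move=> fF; split.
  move=> _ Y mY; apply: countable_measurable; first by move=> t; exact: measurable_set1.
  by apply: finite_set_countable; apply: finite_setIl.
have /compact_bounded[K [_ HK]] := finite_compact (finite_image f fF).
by exists (K + 1) => x Fx; apply: (HK (K + 1)); [rewrite ltrDl|exists x].
Qed.

(** * Measurability and finite area of plane sets *)

Section PlaneMeasure.
Variable R : realType.
Local Notation plane := (measurableTypeR R * measurableTypeR R)%type.

Lemma nbhs_real_rat (x : R) (A : set R) : nbhs x A ->
  exists q r : rat, ratr q < x < ratr r /\ `]ratr q, ratr r[ `<=` A.
Proof.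
move=> /nbhs_ballP[e /= e0 xA].
have [q] := @rat_in_itvoo R (x - e) x ltac:(by rewrite ltrBlDr ltrDl).
rewrite in_itv /= => /andP[xq qx].
have [r] := @rat_in_itvoo R x (x + e) ltac:(by rewrite ltrDl).
rewrite in_itv /= => /andP[xr rx].
exists q, r; split; first by rewrite qx.
move=> y /=; rewrite in_itv /= => /andP[qy yr]; apply: xA.
by rewrite -ball_normE /= ltr_distlC; lra.
Qed.

(** Links the product topology with the product sigma-algebra: an open set is the union of the
    countably many rational boxes that it contains. *)
Lemma open_measurable_plane (U : set (R * R)) : open U -> measurable (U : set plane).
Proof.
move=> oU.
pose box (i : rat * rat * (rat * rat)) : set plane :=
  `]ratr i.1.1, ratr i.1.2[ `*` `]ratr i.2.1, ratr i.2.2[.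
rewrite (_ : U = \bigcup_i (if `[< box i `<=` U >] then box i else set0)).
  apply: countable_bigcupT_measurable => // i.
  by case: ifP => // _; apply: measurableX; exact: measurable_itv.
apply/seteqP; split => [x Ux|x [i _]]; last by case: ifP => // /asboolP; apply.
have [[A B] /= [xA xB] ABU] : nbhs x U by move: oU; rewrite openE; apply.
have [q [r [xqr qrA]]] := nbhs_real_rat xA.
have [q' [r' [xqr' qrB]]] := nbhs_real_rat xB.
exists ((q, r), (q', r')) => //; rewrite ifT; last first.
  by apply/asboolP => y [y1 y2]; apply: ABU; split; [exact: qrA|exact: qrB].
by split; rewrite /= in_itv.
Qed.

Lemma bounded_leb2_lty (A : set (R * R)) :
  measurable (A : set plane) -> bounded_set A -> (@leb2 R A < +oo)%E.
Proof.
move=> mA [K [_ AK]].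
(* Boundedness provides bounds only by constants strictly above [K], hence [K + 1]; for the max norm
   the resulting ball is a square. *)
pose I : set (measurableTypeR R) := `[- (K + 1), K + 1]%classic.
have mI : measurable I by exact: measurable_itv.
apply: (@le_lt_trans _ _ (@leb2 R (I `*` I))).
  apply: le_measure; rewrite ?inE//; first exact: measurableX.
  move=> x Ax; have /= := AK (K + 1) _ x Ax.
  rewrite ltrDl ltr01 => /(_ isT); rewrite prod_normE ge_max => /andP[h1 h2].
  by split; rewrite /I /= in_itv /= -ler_norml.
have -> : @leb2 R (I `*` I) = (@lebesgue_measure R I * @lebesgue_measure R I)%E.
  exact: product_measure1E.
rewrite /I lebesgue_measure_itv/=.
by case: ifP => _; rewrite ?mule0 ?ltry// -EFinB -EFinM ltry.
Qed.

End PlaneMeasure.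

(** * Position of elements, edges and the discrete interface *)

Section Mesh.
Variables (R : realType) (M : ife_data R).
Local Notation plane := (R * R)%type.
Local Notation simplex := {set vertex M}.
Implicit Types (S T e : simplex) (x y p : plane).

Lemma mesh_element T : triangulation M -> T \in Th M ->
  #|T| = 3%N /\ affinely_independent T.
Proof. by move=> [H _ _ _]; exact: H. Qed.

Lemma closed_element_sub_closure T : triangulation M -> T \in Th M ->
  closed_simplex T `<=` closure (Omega M).
Proof. by move=> [_ _ -> _] TTh x Tx; exists T. Qed.

Lemma open_element T : triangulation M -> T \in Th M -> open (open_simplex T).
Proof. by move=> tri /(mesh_element tri)[]; exact: open_open_simplex. Qed.

Lemma open_element_sub T : convex_polygonal_domain (Omega M) ->
  triangulation M -> T \in Th M -> open_simplex T `<=` Omega M.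
Proof.
move=> cO tri TTh; apply: open_sub_convex_polygonal => //; first exact: open_element.
by move=> x /open_closed_simplex; exact: closed_element_sub_closure.
Qed.

(** An edge of the mesh may lie on the boundary of the domain; one point [p] inside excludes this,
    since a supporting line touching the open edge would contain all of it. For interface edges, [p]
    is a point of the curve. *)
Lemma open_edge_sub T e p : convex_polygonal_domain (Omega M) ->
  triangulation M -> T \in Th M -> e \subset T ->
  open_simplex e p -> Omega M p -> open_simplex e `<=` Omega M.
Proof.
move=> [_ _ [k [n [c Oe]]]] tri TTh eT [l' [l0' l1' ->]] Op x [l [l0 l1 ->]].
have le_vtx i a : a \in e -> dotp (n i) (vtx a) <= c i.
  move=> ae; apply: closure_half_planes; rewrite -Oe.
  apply: (closed_element_sub_closure tri TTh); apply: vtx_closed_simplex.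
  exact: (fintype.subsetP eT).
rewrite Oe in Op *; move=> i /=; rewrite ltNge; apply/negP => h.
(* The nonnegative gaps at the vertices have a vanishing combination with positive weights, so each
   gap is zero. *)
have eq_vtx a : a \in e -> c i - dotp (n i) (vtx a) = 0.
  move=> ae.
  have s0 : \sum_(b in e) l b * (c i - dotp (n i) (vtx b)) = 0.
    apply: le_anti; rewrite sumr_ge0 ?andbT; last first.
      by move=> b be; rewrite mulr_ge0 ?subr_ge0 ?le_vtx// ltW// l0.
    under eq_bigr do rewrite mulrBr.
    by rewrite sumrB -mulr_suml l1 mul1r subr_le0 -dotp_sum.
  have /(_ s0 a ae)/eqP : \sum_(b in e) l b * (c i - dotp (n i) (vtx b)) = 0 ->
      forall b, b \in e -> l b * (c i - dotp (n i) (vtx b)) = 0.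
    apply: psumr_eq0P => b be.
    by rewrite mulr_ge0 ?subr_ge0 ?le_vtx// ltW// l0.
  by rewrite mulf_eq0 gt_eqF ?l0//= => /eqP.
have := Op i; rewrite /= dotp_sum (eq_bigr (fun a => l' a * c i)).
  by rewrite -mulr_suml l1' mul1r ltxx.
by move=> a ae; congr (_ * _); apply/esym/eqP; rewrite -subr_eq0 eq_vtx.
Qed.

Lemma closed_simplexD1 T a (l : vertex M -> R) :
  a \in T -> l a = 0 -> (forall b, b \in T -> 0 <= l b) ->
  \sum_(b in T) l b = 1 ->
  closed_simplex (T :\ a)%SET (\sum_(b in T) l b *: vtx b).
Proof.
move=> aT la l0 l1; exists l; split.
- by move=> b; rewrite !inE => /andP[_]; exact: l0.
- by rewrite -l1 [RHS](big_setD1 a)//= la add0r.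
- by rewrite (big_setD1 a)//= la scale0r add0r.
Qed.

Lemma facet_in_Eh T a : T \in Th M -> #|T| = 3%N -> a \in T -> (T :\ a)%SET \in @Eh R M.
Proof.
move=> TTh T3 aT; rewrite inE; apply/andP; split.
  by move: (cardsD1 a T); rewrite aT T3 => /eqP; rewrite -[3%N]/(1 + 2)%N eqn_add2l eq_sym.
by apply/existsP; exists T; rewrite TTh finset.subD1set.
Qed.

(** The segment through [x] may belong to any interface element [S]. Its inner points lie in the
    open element [S], which no open edge of the mesh meets, so only its two endpoints remain. *)
Lemma Gammah_edge T e x : triangulation M -> assumptionA M ->
  T \in Th M -> e \in @Eh R M -> e \subset T -> open_simplex e x ->
  Gammah M x -> exists T', x = ptD T' \/ x = ptE T'.
Proof.
move=> tri [AT Ae] TTh eEh eT ex [S [iS [s [/andP[s0 s1] xe]]]].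
exists S; have [DE GDE] := AT _ iS; have [SS _] := iS.
have [S3 indS] := mesh_element tri SS.
have [GD [cD _]] : (Gamma M `&` (closed_simplex S `\` open_simplex S)) (ptD S).
  by rewrite GDE; left.
have [GE [cE _]] : (Gamma M `&` (closed_simplex S `\` open_simplex S)) (ptE S).
  by rewrite GDE; right.
have [s00|sn0] := eqVneq s 0; first by left; rewrite xe s00 scale0r addr0.
have [s10|sn1] := eqVneq s 1; first by right; rewrite xe s10 scale1r addrC subrK.
exfalso.
have {sn0}s0 : 0 < s by rewrite lt_neqAle eq_sym sn0.
have {sn1}s1 : 0 < 1 - s by rewrite subr_gt0 lt_neqAle sn1.
have [lD [lD0 lD1 Dl]] := cD; have [lE [lE0 lE1 El]] := cE.
(* A zero coordinate of [x] would be zero for both endpoints; these would then lie on one closed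
   edge, which meets the curve at most once, although they are distinct. *)
have Sx : open_simplex S x.
  exists (fun a => (1 - s) * lD a + s * lE a); split.
  - move=> a aS; rewrite lt_neqAle addr_ge0 ?mulr_ge0 ?lD0 ?lE0 ?ltW// andbT eq_sym.
    apply/eqP => /eqP; rewrite paddr_eq0 ?mulr_ge0 ?lD0 ?lE0 ?ltW//.
    rewrite !mulf_eq0 (gt_eqF s0) (gt_eqF s1)/= => /andP[/eqP lDa /eqP lEa].
    apply: DE; apply: (Ae (S :\ a)%SET) => //; first exact: facet_in_Eh.
    + by rewrite Dl; exact: closed_simplexD1.
    + by rewrite El; exact: closed_simplexD1.
  - by rewrite big_split /= -!mulr_sumr lD1 lE1 !mulr1 subrK.
  - rewrite [RHS](eq_bigr (fun a => (1 - s) *: (lD a *: vtx a) + s *: (lE a *: vtx a))).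
      rewrite big_split /= -!scaler_sumr -Dl -El xe scalerBl scale1r scalerBr.
      by rewrite -addrA [- _ + _]addrC.
    by move=> a _; rewrite !scalerA -scalerDl.
(* As [x] lies in both elements and there are no hanging nodes, [S] is contained in [T]; as [x] lies
   on [e], the three vertices of [S] are then among the two of [e]. *)
have [_ _ _ /(_ S T SS TTh) ST] := tri.
have : closed_simplex (S :&: T)%SET x.
  rewrite -ST; split; first exact: open_closed_simplex.
  by apply: closed_simplexS eT _; exact: open_closed_simplex.
move=> /(open_simplex_sub indS (subxx _) (finset.subsetIl _ _) Sx) => SST.
have {SST}ST' : S \subset T := fintype.subset_trans SST (finset.subsetIr _ _).
have [T3 indT] := mesh_element tri TTh.
have := open_simplex_sub indT ST' eT Sx (open_closed_simplex ex).
move=> /subset_leq_card; rewrite S3.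
by move: eEh; rewrite inE => /andP[/eqP->].
Qed.

(** Each such open edge contains D or E, and open edges of [T] with a common point coincide.
    Containing D or not is therefore an injective Boolean label. *)
Lemma card_interface_edges T (P : pred {set vertex M}) :
  triangulation M -> assumptionA M -> T \in Th M -> 
  (forall e, P e -> [/\ interface_edge e, e \subset T & interface_element T]) ->
  (#|P| <= 2)%N.
Proof.
move=> tri [AT _] TTh HP.
have [T3 indT] := mesh_element tri TTh.
have meet e : P e -> exists p, open_simplex e p /\ (p = ptD T \/ p = ptE T).
  move=> /HP[[eEh [p [ep Gp]]] eT iT]; exists p; split => //.
  have [_ DE] := AT _ iT.
  have : (Gamma M `&` (closed_simplex T `\` open_simplex T)) p.
    split=> //; split.
      by apply: closed_simplexS eT _; exact: open_closed_simplex.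
    move=> Tp; have := open_simplex_sub indT (subxx _) eT Tp (open_closed_simplex ep).
    move=> /subset_leq_card; rewrite T3.
    by move: eEh; rewrite inE => /andP[/eqP->].
  by rewrite DE.
pose f e : bool := `[< open_simplex e (ptD T) >].
rewrite -card_bool -(card_in_imset (f := f) (D := P)) ?max_card//.
move=> e e' /[dup] Pe /HP[_ eT _] /[dup] Pe' /HP[_ e'T _].
have key p : open_simplex e p -> open_simplex e' p -> e = e'.
  move=> ep e'p; apply/eqP; rewrite finset.eqEsubset.
  have ce := open_closed_simplex ep; have ce' := open_closed_simplex e'p.
  by rewrite (open_simplex_sub indT eT e'T ep ce') (open_simplex_sub indT e'T eT e'p ce).
have [p [ep pDE]] := meet _ Pe; have [p' [e'p' pDE']] := meet _ Pe'.
move=> fe.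
have [eD|neD] := pselect (open_simplex e (ptD T)).
  apply: (key (ptD T)) => //; apply/asboolP; rewrite -/(f e') -fe; exact/asboolP.
have ne'D : ~ open_simplex e' (ptD T).
  by move=> h; apply: neD; apply/asboolP; rewrite -/(f e) fe; exact/asboolP.
apply: (key (ptE T)).
  by case: pDE => pe; [case: neD|]; rewrite -pe.
by case: pDE' => pe; [case: ne'D|]; rewrite -pe.
Qed.

End Mesh.

(** * Traces and derivatives of locally affine functions *)

Section Traces.
Variable R : realType.
Local Notation plane := (R * R)%type.
Implicit Types (A : set plane) (f g : plane -> R) (x : plane).

(** The closure hypothesis makes the filter of neighbourhoods within [A] proper, so that [lim]
    returns the limit of [g]. *)
Lemma trace_near A f g x : closure A x ->
  (\forall y \near x, A y -> f y = g y) -> {for x, continuous g} ->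
  trace A f x = g x.
Proof.
move=> Ax fg cg; rewrite /trace.
have PF : ProperFilter (within A (nbhs x)) by apply: within_nbhs_proper.
apply: cvg_lim => //.
apply: (@cvg_trans _ (g y @[y --> within A (nbhs x)])); last exact: cvg_within_filter.
apply: near_eq_cvg.
by rewrite near_withinE; apply: filterS fg => y H Ay; rewrite H.
Qed.

(** The two image filters coincide, so the equality persists where no limit exists. *)
Lemma eq_trace A f g x : (forall y, A y -> f y = g y) -> trace A f x = trace A g x.
Proof.
move=> fg; rewrite /trace; congr (lim _); rewrite eqEsubset; split.
all: by apply: near_eq_cvg; rewrite near_withinE; apply: nearW => y /fg ->.
Qed.

Lemma derive_affine_fun (g : plane) (c : R) (u x : plane) :
  'D_u (affine_fun g c) x = dotp g u.
Proof.
apply: cvg_lim => //; apply: cvg_trans (cvg_cst (dotp g u)).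
apply: near_eq_cvg; near=> h.
have h0 : h != 0 by near: h; exact: nbhs_dnbhs_neq.
rewrite /= /affine_fun dotpDr dotpZr /GRing.scale /=.
by rewrite -[_ + _ + c]addrA addrK mulKf.
by typeclasses eauto.
Unshelve. all: by end_near. Qed.

End Traces.

(** * The elementwise gradient on affine pieces *)

Section Gradient.
Variables (R : realType) (M : ife_data R).
Local Notation plane := (R * R)%type.

Lemma grad_affine (U : set plane) (v : plane -> R) (g : plane) (c : R) (x : plane) :
  open U -> U x -> ~ Gammah M x -> (forall y, U y -> v y = affine_fun g c y) ->
  grad M v x = g.
Proof.
move=> oU Ux Gx vU; rewrite /grad ifF; last by apply/negP; rewrite inE.
have nv : \near x, v x = affine_fun g c x.
  have : nbhs x U by move: oU; rewrite openE; apply.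
  by apply: filterS => y /vU.
rewrite !(near_eq_derive _ nv) !derive_affine_fun /dotp /=.
by rewrite !mulr0 !mulr1 addr0 add0r -surjective_pairing.
Qed.

End Gradient.

(** * Traces of discrete functions and fluxes along an edge *)

Section Edge.
Variables (R : realType) (M : ife_data R).
Local Notation plane := (R * R)%type.
Local Notation simplex := {set vertex M}.

(** Removes the enumeration, and its default value, from [edge_point]. Coinciding endpoints would
    put a vertex into the simplex of another one, which affine independence excludes. *)
Lemma edge_pointE (e T : simplex) : #|e| = 2%N -> affinely_independent T -> e \subset T ->
  exists p q : plane, [/\ p <> q, forall t, edge_point e t = p + t *: (q - p) &
    forall t, 0 < t < 1 -> open_simplex e (edge_point e t)].
Proof.
rewrite cardE => e2 iT eT.
case Ee : (enum e) e2 => [|a [|b [|]]] //= _.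
have ab : a != b by have := enum_uniq e; rewrite Ee /= inE andbT.
have eab : e = [set a; b]%SET.
  by apply/setP => z; rewrite -(mem_enum e) Ee !inE.
exists (vtx a), (vtx b); split.
- move=> vab.
  have sa : a \in e by rewrite eab !inE eqxx.
  have sb : b \in e by rewrite eab !inE eqxx orbT.
  have e1 : vtx a = \sum_(c in [set a]%SET) 1 *: vtx c by rewrite big_set1 scale1r.
  have : open_simplex [set a]%SET (vtx a).
    by exists (fun=> 1); split => //; rewrite big_set1.
  have : closed_simplex [set b]%SET (vtx a) by rewrite vab; apply: vtx_closed_simplex; rewrite inE.
  move=> cb oa; have := open_simplex_sub iT _ _ oa cb.
  rewrite !finset.sub1set (fintype.subsetP eT _ sa) (fintype.subsetP eT _ sb) inE => /(_ isT isT).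
  by apply/negP.
- by move=> t; rewrite /edge_point Ee.
- move=> t /andP[t0 t1]; rewrite /edge_point Ee.
  exists (fun c => if c == a then 1 - t else t); rewrite eab; split.
  + by move=> c _; case: ifP; rewrite ?subr_gt0.
  + by rewrite big_setU1 ?inE//= big_set1 eqxx eq_sym (negbTE ab) subrK.
  + rewrite big_setU1 ?inE//= big_set1 eqxx eq_sym (negbTE ab).
    by rewrite scalerBl scale1r scalerBr -addrA [- _ + _]addrC.
Qed.

Hypothesis cO : convex_polygonal_domain (Omega M).
Hypothesis GO : Gamma M `<=` Omega M.
Hypothesis tri : triangulation M.
Hypothesis aA : assumptionA M.
Hypothesis sub : discrete_subdomains M.

Lemma open_Omegahp : open (Omegahp M).
Proof. by have [[_ _ _ [[oP _ _] _] _] _ _] := sub. Qed.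

Lemma open_Omegahm : open (Omegahm M).
Proof. by have [[_ _ _ [_ [oP _ _]] _] _ _] := sub. Qed.

Lemma Omegah_cover (x : plane) : Omega M x -> [\/ Omegahp M x, Omegahm M x | Gammah M x ].
Proof.
move: sub => [[_ OG _ _ _] _ _] Ox.
have [Gx|Gx] := pselect (Gammah M x); first by constructor 3.
have : (Omega M `\` Gammah M) x by split.
by rewrite OG => -[]; [constructor 1|constructor 2].
Qed.

Lemma Omegahp_Gammah (x : plane) : Omegahp M x -> ~ Gammah M x.
Proof.
move: sub => [[_ OG _ _ _] _ _] px.
have [] : (Omega M `\` Gammah M) x by rewrite OG; left.
by [].

Qed.

Lemma Omegahm_Gammah (x : plane) : Omegahm M x -> ~ Gammah M x.
Proof.
move: sub => [[_ OG _ _ _] _ _] px.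
have [] : (Omega M `\` Gammah M) x by rewrite OG; right.
by [].

Qed.

Lemma Omegahm_notp (x : plane) : Omegahm M x -> ~ Omegahp M x.
Proof.
move: sub => [[_ _ pm _ _] _ _] mx px.
have : (Omegahp M `&` Omegahm M) x by split.
by rewrite pm.
Qed.

Lemma betah_p (x : plane) : Omegahp M x -> betah M x = betap M.
Proof. by move=> px; rewrite /betah ifT// inE. Qed.

Lemma betah_m (x : plane) : Omegahm M x -> betah M x = betam M.
Proof. by move=> px; rewrite /betah ifF//; apply/negP; rewrite inE; exact: Omegahm_notp. Qed.

(** Common framework for discrete functions and their fluxes: the two pieces need not match at D and
    E, and values on the discrete interface are free. *)
Definition affine_off_interface (T : simplex) (f : plane -> R) :=
  exists gp gm cp cm,
    (forall x, open_simplex T x -> Omegahp M x -> f x = affine_fun gp cp x) /\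
    (forall x, open_simplex T x -> Omegahm M x -> f x = affine_fun gm cm x).

Let I : set (measurableTypeR R) := `]0, 1[%classic.

Lemma bounded_measurable_affine_line (J : set (measurableTypeR R))
    (g : plane) (c : R) (p q : plane) : J `<=` I ->
  bounded_measurable J (fun t : R => affine_fun g c (p + t *: (q - p))).
Proof.
move=> JI; rewrite /affine_fun.
apply: (@eq_bounded_measurable _ _ _ _ (fun t : R => (dotp g p + c) + t * dotp g (q - p))).
  by move=> t _; rewrite [in RHS]dotpDr dotpZr addrAC.
apply: bounded_measurableD; first exact: bounded_measurable_cst.
apply: bounded_measurableM; last exact: bounded_measurable_cst.
split; first exact: measurable_id.
by exists 1 => t /JI; rewrite /I /= in_itv /= => /andP[t0 t1]; rewrite gtr0_norm// ltW.
Qed.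

(* On the finite set of points of e lying on Gamma_h, the trace may be a junk
   value of lim. *)
Lemma trace_bounded_measurable (e T : simplex) (f : plane -> R) :
  interface_edge e -> T \in Th M -> e \subset T -> affine_off_interface T f ->
  bounded_measurable I (fun t => trace (open_simplex T) f (edge_point e t)).
Proof.
move=> [eEh [p0 [ep0 /GO Op0]]] TTh eT [gp [gm [cp [cm [fp fm]]]]].
have [T3 iT] := mesh_element tri TTh.
have e2 : #|e| = 2%N by move: eEh; rewrite inE => /andP[/eqP].
have [p [q [pq ept eo]]] := edge_pointE e2 iT eT.
have eO : open_simplex e `<=` Omega M := open_edge_sub cO tri TTh eT ep0 Op0.
have oT : open (open_simplex T) := open_element tri TTh.
have T0 : open_simplex T !=set0.
  exists (\sum_(a in T) 3^-1 *: vtx a); exists (fun=> 3^-1); split => //.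
  by rewrite sumr_const T3 -[LHS]mulr_natr mulVf ?pnatr_eq0.
have clT t : I t -> closure (open_simplex T) (edge_point e t).
  rewrite /I /= in_itv /= => t01; apply: (closure_open_simplex T0).
  by apply: closed_simplexS eT _; apply: open_closed_simplex; exact: eo.
have cep : continuous (edge_point e : R -> plane).
  rewrite (_ : edge_point e = fun t => p + t *: (q - p)); last exact/funext.
  move=> t; apply: cvgD; first exact: cvg_cst.
  by apply: cvgZr_tmp; exact: cvg_id.
have mpre U : open U -> measurable (I `&` (edge_point e @^-1` U) : set (measurableTypeR R)).
  move=> oU; apply: open_measurable; apply: openI; first exact: interval_open.
  by apply: open_comp => // t _; exact: cep.
(* Where the edge runs inside an open side [U], the function is affine in the part of the element
   near the edge point, and the trace is the value of that affine function. *)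
have tr g c U t : open U -> I t -> U (edge_point e t) ->
    (forall x, open_simplex T x -> U x -> f x = affine_fun g c x) ->
    trace (open_simplex T) f (edge_point e t) = affine_fun g c (p + t *: (q - p)).
  move=> oU It Ut fU; rewrite -ept; apply: trace_near; [exact: clT| |exact: continuous_affine_fun].
  have : nbhs (edge_point e t) U by move: oU; rewrite openE; apply.
  by apply: filterS => y Uy Ty; exact: fU.
pose F : set R := I `&` (edge_point e @^-1` Gammah M).
(* The parametrisation is injective and maps [F] into the points D, E of the finitely many
   elements. *)
have fF : finite_set F.
  apply: (@sub_finite_set _ _ (edge_point e @^-1` (range (@ptD R M) `|` range (@ptE R M)))).
    move=> t [It Gt]; rewrite /I /= in_itv /= in It.
    have [S [SD|SE]] := Gammah_edge tri aA TTh eEh eT (eo _ It) Gt.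
      by left; exists S.
    by right; exists S.
  apply: finite_preimage; last first.
    by rewrite finite_setU; split; apply: finite_image; exact: finite_finset.
  move=> t s _ _; rewrite !ept => /addrI/eqP; rewrite -subr_eq0 -scalerBl scaler_eq0 !subr_eq0.
  by case/orP => /eqP // qp; case: pq.
have -> : I = (I `&` (edge_point e @^-1` Omegahp M)) `|`
              ((I `&` (edge_point e @^-1` Omegahm M)) `|` F).
  apply/seteqP; split => [t It|t [[]|[[]|[]]]]//.
  have /eO/Omegah_cover [] : open_simplex e (edge_point e t).
    by apply: eo; move: It; rewrite /I /= in_itv.
  + by left.
  + by right; left.
  + by right; right.
have mF : measurable (F : set (measurableTypeR R)).
  by apply: countable_measurable; [move=> t; exact: measurable_set1|exact: finite_set_countable].
apply: bounded_measurableU; first exact: (mpre _ open_Omegahp).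
- by apply: measurableU; [exact: (mpre _ open_Omegahm)|exact: mF].
- apply: eq_bounded_measurable; last first.
    by apply: (@bounded_measurable_affine_line _ gp cp p q) => t [].
  by move=> t [It pt]; rewrite (tr gp cp _ _ open_Omegahp).
apply: bounded_measurableU => //; first exact: (mpre _ open_Omegahm).
- apply: eq_bounded_measurable; last first.
    by apply: (@bounded_measurable_affine_line _ gm cm p q) => t [].
  by move=> t [It pt]; rewrite (tr gm cm _ _ open_Omegahm).
- exact: bounded_measurable_finite.
Qed.

Lemma Sh_affine (T : simplex) (v : plane -> R) : Sh T v -> affine_off_interface T v.
Proof. by move=> [gp [gm [cp [cm [vp vm _ _ _]]]]]; exists gp, gm, cp, cm. Qed.

(** Each side of the element is open and avoids the discrete interface, so the derivatives there are
    those of one affine function. *)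
Lemma Sh_grad (T : simplex) (v : plane -> R) : T \in Th M -> Sh T v ->
  exists gp gm, forall x, open_simplex T x ->
    (Omegahp M x -> grad M v x = gp) /\ (Omegahm M x -> grad M v x = gm).
Proof.
move=> TTh [gp [gm [cp [cm [vp vm _ _ _]]]]]; exists gp, gm => x Tx; split => Ox.
  apply: (@grad_affine _ _ (open_simplex T `&` Omegahp M) _ _ cp) => //.
  - by apply: openI; [exact: open_element|exact: open_Omegahp].
  - exact: Omegahp_Gammah.
  - by move=> y [Ty Oy]; exact: vp.
apply: (@grad_affine _ _ (open_simplex T `&` Omegahm M) _ _ cm) => //.
- by apply: openI; [exact: open_element|exact: open_Omegahm].
- exact: Omegahm_Gammah.
- by move=> y [Ty Oy]; exact: vm.
Qed.

(** The flux is constant on either side, hence affine with zero slope, and its traces are covered by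
    the same argument as those of [v]. *)
Lemma flux_affine (T : simplex) (v : plane -> R) (n : plane) : T \in Th M -> Sh T v ->
  affine_off_interface T (fun x => betah M x * dotp (grad M v x) n).
Proof.
move=> TTh /(Sh_grad TTh)[gp [gm H]].
exists 0, 0, (betap M * dotp gp n), (betam M * dotp gm n).
by split => x /H[Hp Hm] Ox; rewrite /affine_fun dotp0l add0r
  ?(betah_p Ox) ?(betah_m Ox) ?(Hp Ox) ?(Hm Ox).
Qed.

End Edge.

(** * Square-integrable fields and a weighted Young inequality *)

Section Quadratic.
Variables (R : realType) (D : set (measurableTypeR R * measurableTypeR R)).
Hypothesis mD : measurable D.
Implicit Types (f g b : R * R -> R) (u w : R * R -> R * R).

Lemma bounded_measurable_L2 f : (@leb2 R D < +oo)%E -> bounded_measurable D f -> L2 D f.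
Proof.
move=> fD bf; split; first by case: bf.
by under eq_fun do rewrite expr2; exact: bounded_measurable_integrable (bounded_measurableM bf bf).
Qed.

(** The integrable majorant comes from |fg| <= f^2 + g^2. *)
Lemma L2_mul_integrable f g : L2 D f -> L2 D g ->
  (@leb2 R).-integrable D (EFin \o (fun x => f x * g x)).
Proof.
move=> [mf f2] [mg g2].
apply: le_integrable (integrableD mD f2 g2) => //.
  by apply/measurable_EFinP; exact: measurable_funM.
move=> x _; rewrite /= lee_fin normrM [leRHS]ger0_norm ?addr_ge0 ?sqr_ge0//.
rewrite -(real_normK (num_real (f x))) -(real_normK (num_real (g x))).
have := sqr_ge0 (`|f x| - `|g x|); have := mulr_ge0 (normr_ge0 (f x)) (normr_ge0 (g x)).
by rewrite sqrrB; move: (`|f x|) (`|g x|) => a c; rewrite -mulr_natl; lra.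
Qed.

Lemma bounded_mul_integrable b f : bounded_measurable D b ->
  (@leb2 R).-integrable D (EFin \o f) ->
  (@leb2 R).-integrable D (EFin \o (fun x => b x * f x)).
Proof.
move=> [mb [K bK]] fi.
apply: le_integrable (integrableZl mD K fi) => //.
  apply/measurable_EFinP; apply: measurable_funM => //.
  by apply/measurable_EFinP; exact: measurable_int fi.
move=> x Dx; rewrite /= lee_fin !normrM ler_wpM2r//.
by rewrite (le_trans (bK _ Dx))// ler_norm.
Qed.

Lemma weighted_dotp_integrable b u w : bounded_measurable D b ->
  L2vec D u -> L2vec D w ->
  (@leb2 R).-integrable D (EFin \o (fun x => b x * dotp (u x) (w x))).
Proof.
move=> bb [u1 u2] [w1 w2]; apply: bounded_mul_integrable => //.
have := integrableD mD (L2_mul_integrable u1 w1) (L2_mul_integrable u2 w2).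
by apply: eq_integrable => // x _.
Qed.

(* Completing the square: the integrand is the weighted square of 2 u - w / 2. *)
Lemma weighted_young b u w : (forall x, D x -> 0 <= b x) -> bounded_measurable D b ->
  L2vec D u -> L2vec D w ->
  2 * \int[@leb2 R]_(x in D) (b x * dotp (u x) (w x)) <=
  4 * \int[@leb2 R]_(x in D) (b x * dotp (u x) (u x)) +
  1 / 4 * \int[@leb2 R]_(x in D) (b x * dotp (w x) (w x)).
Proof.
move=> b0 bb Lu Lw.
have iuw := weighted_dotp_integrable bb Lu Lw.
have iuu := weighted_dotp_integrable bb Lu Lu.
have iww := weighted_dotp_integrable bb Lw Lw.
have iZ (c : R) f : (@leb2 R).-integrable D (EFin \o f) ->
    (@leb2 R).-integrable D (EFin \o (fun x => c * f x)).
  by move=> /(integrableZl mD c); apply: eq_integrable.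
have iD f g : (@leb2 R).-integrable D (EFin \o f) -> (@leb2 R).-integrable D (EFin \o g) ->
    (@leb2 R).-integrable D (EFin \o (fun x => f x + g x)).
  by move=> fi /(integrableD mD fi); apply: eq_integrable.
rewrite -!RintegralZl// -RintegralD//; [|exact: iZ..].
apply: le_Rintegral => //; first exact: iZ.
  by apply: iD; exact: iZ.
move=> x Dx.
have -> : 4 * (b x * dotp (u x) (u x)) + 1 / 4 * (b x * dotp (w x) (w x)) =
  2 * (b x * dotp (u x) (w x)) +
  b x * ((2 * (u x).1 - (w x).1 / 2) ^+ 2 + (2 * (u x).2 - (w x).2 / 2) ^+ 2).
  by rewrite /dotp; field.
by rewrite lerDl mulr_ge0 ?b0// addr_ge0 ?sqr_ge0.
Qed.

End Quadratic.

(** Double counting: each pair is written as a sum over [A] with an indicator, the sums are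
    exchanged, and every [X i] occurs at most [k] times. It is used with elements for [I] and edges
    for [J]. *)
Lemma sum_shared_le (R : realType) (I J : finType) (A : {set I}) (P : pred J)
    (s1 s2 : J -> I) (X : I -> R) (k : nat) :
  (forall i, 0 <= X i) ->
  (forall j, P j -> [/\ s1 j \in A, s2 j \in A & s1 j != s2 j]) ->
  (forall i, i \in A -> (#|[pred j | P j && ((i == s1 j) || (i == s2 j))]| <= k)%N) ->
  \sum_(j | P j) (X (s1 j) + X (s2 j)) <= k%:R * \sum_(i in A) X i.
Proof.
move=> X0 sA ck.
have -> : \sum_(j | P j) (X (s1 j) + X (s2 j)) =
    \sum_(j | P j) \sum_(i in A) (if (i == s1 j) || (i == s2 j) then X i else 0).
  apply: eq_bigr => j /sA[s1A s2A s12].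
  rewrite -big_mkcondr (eq_bigl (mem [set s1 j; s2 j]%SET)).
    by rewrite big_setU1 ?inE//= big_set1.
  move=> i; rewrite !inE; apply: andb_idl.
  by case/orP => /eqP->.
rewrite exchange_big mulr_sumr; apply: ler_sum => i iA.
rewrite -big_mkcondr (eq_bigl (mem [pred j | P j && ((i == s1 j) || (i == s2 j))])) //.
by rewrite sumr_const -[leLHS]mulr_natl ler_wpM2r// ler_nat; exact: ck.
Qed.

(** * Edgewise estimate and coercivity *)

Section Coercivity.
Variables (R : realType) (M : ife_data R).
Local Notation plane := (R * R)%type.
Local Notation mplane := (measurableTypeR R * measurableTypeR R)%type.
Local Notation simplex := {set vertex M}.
Hypothesis cO : convex_polygonal_domain (Omega M).
Hypothesis GO : Gamma M `<=` Omega M.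
Implicit Types (T e : simplex) (v : plane -> R).
Hypothesis betap0 : 0 < betap M.
Hypothesis betam0 : 0 < betam M.
Hypothesis tri : triangulation M.
Hypothesis aA : assumptionA M.
Hypothesis shared : interface_edges_shared M.
Hypothesis normals : edge_normals M.
Hypothesis sub : discrete_subdomains M.

Lemma betah_gt0 x : 0 < betah M x.
Proof. by rewrite /betah; case: ifP. Qed.

Lemma measurable_Omega : measurable (Omega M : set mplane).
Proof. exact: open_measurable_plane (convex_polygonal_open cO). Qed.

Lemma leb2_Omega : (@leb2 R (Omega M) < +oo)%E.
Proof. by apply: bounded_leb2_lty; [exact: measurable_Omega|case: cO]. Qed.

Lemma measurable_element T : T \in Th M ->
  measurable (open_simplex T : set mplane).
Proof. by move=> TTh; exact: open_measurable_plane (open_element tri TTh). Qed.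

Lemma betah_bounded_measurable :
  @bounded_measurable _ mplane R (Omega M) (betah M).
Proof.
have mp : measurable (Omegahp M : set mplane).
  exact: open_measurable_plane (open_Omegahp sub).
rewrite -(setDUK (@subIsetr _ (Omegahp M) (Omega M))).
have mpO := measurableI _ _ mp measurable_Omega.
apply: bounded_measurableU => //; first exact: measurableD measurable_Omega mpO.
- apply: eq_bounded_measurable (bounded_measurable_cst _ (betap M)).
  by move=> x [px _]; rewrite (betah_p px).
- apply: eq_bounded_measurable (bounded_measurable_cst _ (betam M)).
  move=> x [Ox npx]; rewrite /betah ifF//; apply/negP; rewrite inE => px.
  exact: npx.
Qed.

(** On an element the gradient has one constant value on each side, and the remaining points lie on
    the discrete interface, where it is 0 by definition. *)
Lemma grad_bounded_measurable T v (f : plane -> R) : T \in Th M -> Sh T v ->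
  @bounded_measurable _ mplane R
    (open_simplex T) (fun x => f (grad M v x)).
Proof.
move=> TTh /(Sh_grad tri sub TTh)[gp [gm H]].
have TO := open_element_sub cO tri TTh.
have mT := measurable_element TTh.
have mp : measurable (Omegahp M : set mplane).
  exact: open_measurable_plane (open_Omegahp sub).
have mm : measurable (Omegahm M : set mplane).
  exact: open_measurable_plane (open_Omegahm sub).
pose Tp := open_simplex T `&` Omegahp M.
pose Tm := open_simplex T `&` Omegahm M.
have mTp : measurable (Tp : set mplane) by exact: measurableI.
have mTm : measurable (Tm : set mplane) by exact: measurableI.
have TE : open_simplex T = (Tp `|` Tm) `|` (open_simplex T `\` (Tp `|` Tm)).
  by rewrite setDUK// => x [[]|[]].
rewrite TE; apply: bounded_measurableU.
- exact: measurableU.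
- by apply: measurableD => //; exact: measurableU.
- apply: bounded_measurableU => //.
  + apply: eq_bounded_measurable (bounded_measurable_cst _ (f gp)).
    by move=> x [/H[Hp _] /Hp ->].
  + apply: eq_bounded_measurable (bounded_measurable_cst _ (f gm)).
    by move=> x [/H[_ Hm] /Hm ->].
- apply: eq_bounded_measurable (bounded_measurable_cst _ (f 0)).
  move=> x [Tx nx]; rewrite /grad ifT// inE.
  have [px|mx|//] := Omegah_cover sub (TO _ Tx).
    by case: nx; left.
  by case: nx; right.
Qed.

(** A common point would give the edge normal a positive product with the zero vector. *)
Lemma shared_disjoint e x : interface_edge e ->
  open_simplex (tri1 e) x -> open_simplex (tri2 e) x -> False.
Proof.
move=> /normals[_ _ H] x1 x2; have := H x x x1 x2.
by rewrite subrr dotp0r ltxx.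
Qed.

Definition edge_grad (e : simplex) (v : plane -> R) (x : plane) : plane :=
  if x \in open_simplex (tri1 e) `|` open_simplex (tri2 e) then grad M v x else 0.

Lemma edge_grad_in e v x : (open_simplex (tri1 e) `|` open_simplex (tri2 e)) x ->
  edge_grad e v x = grad M v x.
Proof. by move=> h; rewrite /edge_grad ifT// inE. Qed.

Lemma edge_grad_out e v x : ~ (open_simplex (tri1 e) `|` open_simplex (tri2 e)) x ->
  edge_grad e v x = 0.
Proof. by move=> h; rewrite /edge_grad ifF//; apply/negP; rewrite inE. Qed.

Lemma edge_grad_L2 e v : interface_edge e -> VhIFE M v -> L2vec (Omega M) (edge_grad e v).
Proof.
move=> ie [Shv _ _]; have [i1 i2 _ _ _] := shared ie.
have [T1 _] := i1; have [T2 _] := i2.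
have mU : measurable (open_simplex (tri1 e) `|` open_simplex (tri2 e) :
    set mplane).
  by apply: measurableU; exact: measurable_element.
have UO : open_simplex (tri1 e) `|` open_simplex (tri2 e) `<=` Omega M.
  by move=> x [] /(open_element_sub cO tri); apply.
(* An arbitrary [f] serves both components at once; off the two triangles the value is the constant
   [f 0]. *)
have key (f : plane -> R) :
    @L2 R (Omega M) (fun x => f (edge_grad e v x)).
  apply: bounded_measurable_L2; [exact: measurable_Omega|exact: leb2_Omega|].
  rewrite -(setDUK UO); apply: bounded_measurableU => //.
  - by apply: measurableD => //; exact: measurable_Omega.
  - apply: bounded_measurableU; [exact: measurable_element..| |].
    + apply: eq_bounded_measurable (grad_bounded_measurable f T1 (Shv _ i1)).
      by move=> x xT; rewrite edge_grad_in//; left.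
    + apply: eq_bounded_measurable (grad_bounded_measurable f T2 (Shv _ i2)).
      by move=> x xT; rewrite edge_grad_in//; right.
  - apply: eq_bounded_measurable (bounded_measurable_cst _ (f 0)).
    by move=> x [_ nx]; rewrite edge_grad_out.
by split; exact: key.
Qed.

Lemma edge_grad_We e v : interface_edge e -> VhIFE M v -> We e (edge_grad e v).
Proof.
move=> ie Vv; have [Shv _ _] := Vv; have [i1 i2 _ _ _] := shared ie; split.
- exact: edge_grad_L2.
- by exists v; [exact: Shv|move=> x Tx; rewrite edge_grad_in//; left].
- by exists v; [exact: Shv|move=> x Tx; rewrite edge_grad_in//; right].
- by move=> x Ox n1 n2; rewrite edge_grad_out// => -[].
Qed.

Definition energy (T : simplex) (v : plane -> R) : R :=
  \int[@leb2 R]_(x in open_simplex T) (betah M x * dotp (grad M v x) (grad M v x)).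

Lemma energy_ge0 T v : 0 <= energy T v.
Proof. by apply: Rintegral_ge0 => x _; rewrite mulr_ge0 ?dotp_ge0// ltW ?betah_gt0. Qed.

Lemma sqr_normh v : normh M v ^+ 2 = \sum_(T in Th M) energy T v.
Proof.
rewrite /normh sqr_sqrtr; last by apply: sumr_ge0 => T _; exact: sqr_ge0.
apply: eq_bigr => T _; rewrite /L2norm_vec sqr_sqrtr; last first.
  by apply: Rintegral_ge0 => x _; exact: sqr_ge0.
apply: eq_Rintegral => x _; rewrite sqr_enorm dotpZl dotpZr mulrA -expr2 sqr_sqrtr//.
by rewrite ltW ?betah_gt0.
Qed.

(** The domain splits into two disjoint triangles and a rest on which the extended gradient
    vanishes. *)
Lemma edge_grad_energy e v : interface_edge e -> VhIFE M v ->
  \int[@leb2 R]_(x in Omega M) (betah M x * dotp (edge_grad e v x) (edge_grad e v x)) =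
  energy (tri1 e) v + energy (tri2 e) v.
Proof.
move=> ie Vv; have Lg := edge_grad_L2 ie Vv.
have [[T1 _] [T2 _] _ _ _] := shared ie.
have mT1 := measurable_element T1; have mT2 := measurable_element T2.
have mU := measurableU _ _ mT1 mT2.
have UO : open_simplex (tri1 e) `|` open_simplex (tri2 e) `<=` Omega M.
  by move=> x [] /(open_element_sub cO tri); apply.
have io := weighted_dotp_integrable measurable_Omega betah_bounded_measurable Lg Lg.
rewrite -{1}(setDUK UO) Rintegral_setU//; first last.
- by apply/disj_set2P; rewrite setDIK.
- by rewrite setDUK.
- by apply: measurableD => //; exact: measurable_Omega.
rewrite [X in _ + X](_ : _ = 0) ?addr0; last first.
  under eq_Rintegral => x.
    rewrite inE => -[_ nx]; rewrite edge_grad_out// dotp0r mulr0; over.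
  by rewrite Rintegral_cst ?mul0r//; apply: measurableD => //; exact: measurable_Omega.
rewrite Rintegral_setU//; first last.
- by apply/disj_setPS => x [] /(shared_disjoint ie).
- exact: integrableS measurable_Omega mU UO io.
by congr (_ + _); apply: eq_Rintegral => x; rewrite inE => Tx;
  rewrite edge_grad_in//; [left|right].
Qed.

Let I : set (measurableTypeR R) := `]0, 1[%classic.

Lemma leb_I : (@lebesgue_measure R I < +oo)%E.
Proof. by rewrite /I lebesgue_measure_itv/= lte_fin ltr01 -EFinB ltry. Qed.

Lemma edge_traces e (f : plane -> R) : interface_edge e ->
  affine_off_interface (tri1 e) f -> affine_off_interface (tri2 e) f ->
  bounded_measurable I (fun t => jump e f (edge_point e t)) /\
  bounded_measurable I (fun t => average e f (edge_point e t)).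
Proof.
move=> ie a1 a2; have [[T1 _] [T2 _] _ e1 e2] := shared ie.
have t1 := trace_bounded_measurable cO GO tri aA sub ie T1 e1 a1.
have t2 := trace_bounded_measurable cO GO tri aA sub ie T2 e2 a2.
have cst c := @bounded_measurable_cst _ (measurableTypeR R) R I c.
split.
  apply: eq_bounded_measurable (bounded_measurableD t1 (bounded_measurableM (cst (-1)) t2)).
  by move=> t _; rewrite mulN1r.
exact: bounded_measurableM (bounded_measurableD t1 t2) (cst _).
Qed.

(** Traces see only the interior of the two triangles, where both fields agree; the equality thus
    holds at every point of the plane. *)
Lemma flux_average_edge_grad e v : flux_average e (edge_grad e v) = flux_average e (grad M v).
Proof.
apply/funext => x; rewrite /flux_average /average.
by congr ((_ + _) / _); apply: eq_trace => y Ty; rewrite edge_grad_in//; [left|right].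
Qed.

(** The constant 4 is the weight of the lifting in [sh]; the complementary 1/4 leaves half of the
    energy when each element is charged twice. *)
Lemma edge_coercivity (r : simplex -> (plane -> R) -> (plane -> plane)) e v :
  is_lifting r -> interface_edge e -> VhIFE M v ->
  edge_integral e (fun x => flux_average e (grad M v) x * jump e v x +
                            flux_average e (grad M v) x * jump e v x) <=
  4 * \int[@leb2 R]_(x in Omega M)
        (betah M x * dotp (r e (jump e v) x) (r e (jump e v) x)) +
  1 / 4 * (energy (tri1 e) v + energy (tri2 e) v).
Proof.
move=> Hr ie Vv; have [Shv _ _] := Vv.
have [i1 i2 _ _ _] := shared ie; have [T1 _] := i1; have [T2 _] := i2.
have [mj _] := edge_traces ie (Sh_affine (Shv _ i1)) (Sh_affine (Shv _ i2)).
have [_ mf] := edge_traces ie (flux_affine tri sub (ne e) T1 (Shv _ i1))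
                              (flux_affine tri sub (ne e) T2 (Shv _ i2)).
have mI : measurable I by exact: measurable_itv.
have ij : L2edge e (jump e v).
  split; first by case: mj.
  exact: bounded_measurable_integrable leb_I (bounded_measurableM mj mj).
have [Wr Hlift] := Hr e ie _ ij.
have Wg := edge_grad_We ie Vv.
have [Lr _ _ _] := Wr; have [Lg _ _ _] := Wg.
(* On the diagonal both consistency terms agree, which gives the factor 2 of Young's inequality;
   [edge_grad] turns the flux into that of an admissible test field. *)
have -> : edge_integral e (fun x => flux_average e (grad M v) x * jump e v x +
                            flux_average e (grad M v) x * jump e v x) =
    2 * edge_integral e (fun x => flux_average e (edge_grad e v) x * jump e v x).
  rewrite flux_average_edge_grad /edge_integral RintegralD//.
  - by ring.
  - exact: bounded_measurable_integrable leb_I (bounded_measurableM mf mj).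
  - exact: bounded_measurable_integrable leb_I (bounded_measurableM mf mj).
rewrite -Hlift// -(edge_grad_energy ie Vv).
apply: weighted_young => //.
- exact: measurable_Omega.
- by move=> x _; rewrite ltW ?betah_gt0.
- exact: betah_bounded_measurable.
Qed.

Lemma Ah_coercive (r : simplex -> (plane -> R) -> (plane -> plane)) v :
  is_lifting r -> VhIFE M v -> 1 / 2 * normh M v ^+ 2 <= Ah r v v.
Proof.
move=> Hr Vv; rewrite sqr_normh /Ah /ah /sh.
rewrite -/(energy _ v) (eq_bigr (fun T => energy T v))//.
have edge e : (e \in @Eh R M) && `[< meets_interface e >] -> interface_edge e.
  by move=> /andP[eEh /asboolP].
pose P := [pred e | (e \in @Eh R M) && `[< meets_interface e >]].
have : \sum_(e | P e) (energy (tri1 e) v + energy (tri2 e) v) <= 2%:R * \sum_(T in Th M) energy T v.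
  apply: sum_shared_le => [T|e /edge/shared[[? _] [? _] /eqP]|T TTh] //.
    exact: energy_ge0.
  apply: (card_interface_edges tri aA TTh) => e /andP[/edge ie Te].
  have [i1 i2 _ e1 e2] := shared ie.
  by case/orP: Te => /eqP ->.
have : \sum_(e | P e) edge_integral e (fun x => flux_average e (grad M v) x * jump e v x +
                            flux_average e (grad M v) x * jump e v x) <=
  \sum_(e | P e) (4 * \int[@leb2 R]_(x in Omega M)
        (betah M x * dotp (r e (jump e v) x) (r e (jump e v) x)) +
  1 / 4 * (energy (tri1 e) v + energy (tri2 e) v)).
  by apply: ler_sum => e /edge ie; exact: edge_coercivity.
(* With total energy E, the lifting terms cancel against [sh], and at least E - (1/4)(2E) = E/2
   remains. *)
rewrite big_split /= -!mulr_sumr.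
by lra.
Qed.

End Coercivity.

Theorem lemma11 (R : realType) (M : ife_data R) (sigma : R)
    (r : {set vertex M} -> (R * R -> R) -> (R * R -> R * R))
    (HOmega : convex_polygonal_domain (Omega M))
    (HGamma : closed_C2_curve (Gamma M))
    (Hdiv : divides (Omega M) (Gamma M) (Omegap M) (Omegam M))
    (Hbetap : 0 < betap M) (Hbetam : 0 < betam M)
    (HTh : triangulation M) (Hqu : quasi_uniform M sigma)
    (HA : assumptionA M)
    (Hshared : interface_edges_shared M) (Hne : edge_normals M)
    (Hsub : discrete_subdomains M) (Hnh : discrete_normals M)
    (Hr : is_lifting r) :
  forall v : R * R -> R, VhIFE M v ->
    1 / 2 * normh M v ^+ 2 <= Ah r v v.
Proof.
by move=> v Vv; have [GO _ _ _ _] := Hdiv; exact: (Ah_coercive HOmega GO).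
Qed.
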